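(* Let $S_1 = (G_1, \sigma_1)$ and $S_2 = (G_2, \sigma_2)$ be edge-disjoint signed graphs and let $S = S_1 \square S_2$ be their Cartesian product. If $\chi'(S_1) = \Delta(S_1)$ and $\chi'(S_2) = \Delta(S_2)$, then $\chi'(S) = \Delta(S)$.
   Context: All graphs are simple, finite and undirected. A signed graph is a pair $S=(G,\sigma)$ where $G$ is a graph and $\sigma\colon E(G)\to\{+1,-1\}$; $G$ is the underlying graph. $V(S)$, $E(S)$ and $\Delta(S)$ (maximum degree) refer to the underlying graph. An incidence is a pair $v\text{:}e$ of a vertex $v$ and an edge $e$ having $v$ as an endpoint; $I(G)$ is the set of all incidences. For a positive integer $k$ let $M_k=\{0,\pm1,\ldots,\pm l\}$ if $k=2l+1$ and $M_k=\{\pm1,\ldots,\pm l\}$ if $k=2l$. A $k$-edge-coloring of $S=(G,\sigma)$ is a function $f\colon I(G)\to M_k$ such that $f(u\text{:}uv)=-\sigma(uv)f(v\text{:}uv)$ for each edge $uv$, and $f(u\text{:}uv_1)\neq f(u\text{:}uv_2)$ for any two distinct edges $uv_1\neq uv_2$ at a common vertex $u$. The chromatic index $\chi'(S)$ is the smallest $k$ for which $S$ has a $k$-edge-coloring; a signed graph with no edges has chromatic index $0$. The Cartesian product $S_1\square S_2$ of signed graphs $S_1=(G_1,\sigma_1)$, $S_2=(G_2,\sigma_2)$ is the signed graph with vertex set $V(S_1)\times V(S_2)$ in which $(u,u')(v,v')$ is an edge iff either $u=v$ and $u'v'\in E(S_2)$ (the sign is then $\sigma_2(u'v')$), or $uv\in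 E(S_1)$ and $u'=v'$ (the sign is then $\sigma_1(uv)$). *)

(* Defs.v *)
From HB Require Import structures.
From mathcomp Require Import all_boot all_order all_algebra.
From mathcomp Require Import boolp.
Set Implicit Arguments.
Unset Strict Implicit.
Unset Printing Implicit Defensive.
Import GRing.Theory.
Local Open Scope ring_scope.

(* The vertex set is a subset of an ambient finite type, so that the edge sets
   of two signed graphs can be compared.  [sg_sign] is only meaningful on
   adjacent pairs. *)
Record sgraph (T : finType) := SGraph {
  sg_vertices : {set T};
  sg_adj : rel T;
  sg_sign : T -> T -> int;
  sg_adj_sym : forall u v, sg_adj u v = sg_adj v u;
  sg_adj_irrefl : forall u, ~~ sg_adj u u;
  sg_adj_vertex : forall u v, sg_adj u v -> u \in sg_vertices;
  sg_sign_sym : forall u v, sg_adj u v -> sg_sign u v = sg_sign v u;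
  sg_sign_val : forall u v, sg_adj u v -> sg_sign u v = 1 \/ sg_sign u v = -1
}.

Definition sg_edges (T : finType) (S : sgraph T) : {set {set T}} :=
  [set [set p.1; p.2] | p : T * T & sg_adj S p.1 p.2].

Definition sg_edge_disjoint (T : finType) (S1 S2 : sgraph T) : bool :=
  [disjoint sg_edges S1 & sg_edges S2].

Definition sg_degree (T : finType) (S : sgraph T) (u : T) : nat :=
  #|[set v | sg_adj S u v]|.

Definition sg_max_degree (T : finType) (S : sgraph T) : nat :=
  (\max_(u in sg_vertices S) sg_degree S u)%N.

(* For k = 2l + 1 this is {0, 1, -1, ..., l, -l}; for k = 2l it is
   {1, -1, ..., l, -l}; in particular it is empty for k = 0. *)
Definition colors (k : nat) : pred int :=
  [pred c : int | (`|c| <= k./2)%N && (odd k || (c != 0))].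

(* [f u v] is the color of the incidence of the vertex u with the edge uv; the
   values of f on non-adjacent pairs are irrelevant. *)
Definition edge_coloring (T : finType) (S : sgraph T) (k : nat)
    (f : T -> T -> int) : Prop :=
  [/\ forall u v, sg_adj S u v -> f u v \in colors k,
      forall u v, sg_adj S u v -> f u v = - sg_sign S u v * f v u
    & forall u v1 v2, sg_adj S u v1 -> sg_adj S u v2 -> v1 != v2 ->
        f u v1 <> f u v2].

Definition edge_colorable (T : finType) (S : sgraph T) (k : nat) : Prop :=
  exists f, edge_coloring S k f.

Lemma edge_colorable_ex (T : finType) (S : sgraph T) :
  exists k, `[< edge_colorable S k >].
Proof.
pose r (u : T) : nat := enum_rank u.
have r_inj : injective r by move=> u v /ord_inj /enum_rank_inj.
pose code (u v : T) : nat := (enum_rank (u, v) : nat).+1.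
pose f (u v : T) : int :=
  if (r u < r v)%N then (code u v)%:Z else - sg_sign S u v * (code v u)%:Z.
have sgnorm u v : sg_adj S u v -> `|sg_sign S u v|%N = 1%N.
  by move=> /sg_sign_val [] ->.
have fnorm u v : sg_adj S u v ->
    `|f u v|%N = if (r u < r v)%N then code u v else code v u.
  move=> uv; rewrite /f; case: ifP => // _.
  by rewrite abszM abszN sgnorm // mul1n.
have code_inj u v u' v' : code u v = code u' v' -> (u, v) = (u', v').
  by move=> [] /ord_inj /enum_rank_inj.
exists (#|{: T * T}|.+1).*2; apply/asboolP; exists f; split.
- move=> u v uv; rewrite inE odd_double doubleK /=.
  rewrite -absz_eq0 fnorm //; case: ifP => _;
    by rewrite /= andbT !ltnS ltnW.
- move=> u v uv; rewrite /f (sg_sign_sym uv).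
  case: ltngtP => [ruv|rvu|/r_inj euv] //.
  + rewrite mulrA mulrNN -{1}[code u v : int]mul1r; congr (_ * _).
    rewrite sg_sign_sym; last by rewrite sg_adj_sym.
    by case: (sg_sign_val uv) => ->.
  + by move: uv; rewrite euv (negbTE (sg_adj_irrefl _ _)).
- move=> u v1 v2 uv1 uv2 /eqP ne /(congr1 absz); rewrite !fnorm //.
  case: ifP => h1; case: ifP => h2 /code_inj [].
  + by move=> /ne.
  + by move=> e1 e2; move: uv2; rewrite -e1 (negbTE (sg_adj_irrefl _ _)).
  + by move=> e1 e2; move: uv1; rewrite e1 (negbTE (sg_adj_irrefl _ _)).
  + by move=> /ne.
Qed.

Definition chromatic_index (T : finType) (S : sgraph T) : nat :=
  ex_minn (edge_colorable_ex S).

Section Product.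
Variables (T1 T2 : finType) (S1 : sgraph T1) (S2 : sgraph T2).

Definition prod_vertices : {set T1 * T2} :=
  setX (sg_vertices S1) (sg_vertices S2).

(* Adjacency in S1 or S2 alone does not force the common coordinate to be a
   vertex, as vertex sets may be proper subsets of the ambient types. *)
Definition prod_adj : rel (T1 * T2) := fun x y =>
  [&& x \in prod_vertices, y \in prod_vertices &
      (x.1 == y.1) && sg_adj S2 x.2 y.2 || sg_adj S1 x.1 y.1 && (x.2 == y.2)].

Definition prod_sign (x y : T1 * T2) : int :=
  if x.1 == y.1 then sg_sign S2 x.2 y.2 else sg_sign S1 x.1 y.1.

Lemma prod_adj_sym x y : prod_adj x y = prod_adj y x.
Proof.
rewrite /prod_adj andbCA (eq_sym x.1) (eq_sym x.2).
by rewrite (sg_adj_sym S1) (sg_adj_sym S2).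
Qed.

Lemma prod_adj_irrefl x : ~~ prod_adj x x.
Proof.
by rewrite /prod_adj (negbTE (sg_adj_irrefl S1 _)) (negbTE (sg_adj_irrefl S2 _))
  andbF !andbF.
Qed.

Lemma prod_adj_vertex x y : prod_adj x y -> x \in prod_vertices.
Proof. by case/and3P. Qed.

Lemma prod_sign_sym x y : prod_adj x y -> prod_sign x y = prod_sign y x.
Proof.
rewrite /prod_sign (eq_sym y.1) => /and3P[_ _ /orP[/andP[-> h]|/andP[h _]]].
  exact: sg_sign_sym.
case: eqP => [e|_]; last exact: sg_sign_sym.
by move: h; rewrite e (negbTE (sg_adj_irrefl _ _)).
Qed.

Lemma prod_sign_val x y :
  prod_adj x y -> prod_sign x y = 1 \/ prod_sign x y = -1.
Proof.
rewrite /prod_sign => /and3P[_ _ /orP[/andP[-> h]|/andP[h _]]].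
  exact: sg_sign_val.
case: eqP => [e|_]; last exact: sg_sign_val.
by move: h; rewrite e (negbTE (sg_adj_irrefl _ _)).
Qed.

Definition cartesian_product : sgraph (T1 * T2)%type :=
  SGraph prod_adj_sym prod_adj_irrefl prod_adj_vertex
    prod_sign_sym prod_sign_val.

End Product.

(* Main.v *)
Require Import Defs.
From mathcomp Require Import all_boot all_order all_algebra.
From mathcomp Require Import boolp zify.
Set Implicit Arguments.
Unset Strict Implicit.
Unset Printing Implicit Defensive.
Import GRing.Theory Num.Theory.
Local Open Scope ring_scope.

(** Palettes of sizes k1 and k2 are placed next to each other by shifting the
    absolute values of the nonzero colors of the second factor by [k1./2].  If
    k1 and k2 are not both odd, this already gives k1 + k2 colors.  If both are
    odd, the color 0 has to be given up and a new pair of colors +m, -m takes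
    its place.  The edges of color 0 form a matching in each factor, hence in
    the product they form single edges and balanced 4-cycles.  They are colored
    as follows: each factor has a function p with values 1, -1 such that
    p(u) = - sigma(uv) p(v) on its matching; at the vertex (u, u') the incidence
    coming from the first factor gets p1(u) p2(u') m and the one coming from the
    second factor gets the opposite color. *)

Lemma colors_seq k :
  exists s : seq int, size s = k /\ {subset colors k <= s}.
Proof.
exists (nseq (odd k) 0 ++ ([seq i.+1%:Z | i <- iota 0 k./2]
        ++ [seq - i.+1%:Z | i <- iota 0 k./2])); split.
  by rewrite !size_cat size_nseq !size_map size_iota addnn odd_double_half.
move=> c; rewrite inE /= => /andP[hc hk]; rewrite !mem_cat.
have [c_lt0|c_gt0|c0] := ltrgtP c 0.
- apply/orP; right; apply/orP; right; apply/mapP; exists `|c|.-1%N; last by lia.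
  by rewrite mem_iota; lia.
- apply/orP; right; apply/orP; left; apply/mapP; exists `|c|.-1%N; last by lia.
  by rewrite mem_iota; lia.
- by move: hk; rewrite c0; case: odd.
Qed.

(** The incidences at one vertex have pairwise distinct colors, so its neighbors inject into a
    palette of [k] elements. *)
Lemma max_degree_le_colors (T : finType) (S : sgraph T) k :
  edge_colorable S k -> (sg_max_degree S <= k)%N.
Proof.
move=> [f [fC _ f_inj]]; apply/bigmax_leqP => u _; rewrite /sg_degree cardE.
have [s [sz_s s_colors]] := colors_seq k.
rewrite -sz_s -(size_map (f u)); apply: uniq_leq_size; last first.
  by move=> _ /mapP[v + ->]; rewrite mem_enum inE => uv; apply/s_colors/fC.
rewrite map_inj_in_uniq ?enum_uniq // => v w; rewrite !mem_enum !inE => uv uw.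
by move=> fvw; apply/eqP/negP => /negP vw; apply: (f_inj u v w).
Qed.

Lemma chromatic_index_colorable (T : finType) (S : sgraph T) :
  edge_colorable S (chromatic_index S).
Proof. by rewrite /chromatic_index; case: ex_minnP => k /asboolP. Qed.

Lemma chromatic_index_le (T : finType) (S : sgraph T) k :
  edge_colorable S k -> (chromatic_index S <= k)%N.
Proof.
by move=> Sk; rewrite /chromatic_index; case: ex_minnP => j _; apply; apply/asboolP.
Qed.

(** Since the edges of color 0 form a matching, the required relations involve disjoint pairs of
    vertices. On each pair, the endpoint of lower rank gets 1, which forces the value at the other
    one. *)
Lemma zero_color_potential (T : finType) (S : sgraph T) k f :
  edge_coloring S k f ->
  exists p : T -> int, (forall u, p u = 1 \/ p u = -1) /\
    forall u v, sg_adj S u v -> f u v = 0 -> p u = - sg_sign S u v * p v.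
Proof.
move=> [_ f_sym f_inj].
pose below u := [pred v | [&& sg_adj S u v, f u v == 0
                            & (enum_rank v < enum_rank u)%N]].
(* The default 1 serves both the unmatched vertices and the lower endpoints of matching edges. *)
pose p u : int := if [pick v in below u] is Some v then - sg_sign S u v else 1.
have zero_uniq u v w : sg_adj S u v -> f u v = 0 -> sg_adj S u w -> f u w = 0 -> v = w.
  move=> uv fuv uw fuw; apply/eqP/negP => /negP vw.
  by apply: (f_inj u v w) => //; rewrite fuv fuw.
have p_up u v : sg_adj S u v -> f u v = 0 -> (enum_rank u < enum_rank v)%N -> p u = 1.
  move=> uv fuv ruv; rewrite /p; case: pickP => // w /and3P[uw /eqP fuw].
  by rewrite -(zero_uniq u v w) // ltnNge ltnW.
have p_down u v : sg_adj S u v -> f u v = 0 -> (enum_rank v < enum_rank u)%N ->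
    p u = - sg_sign S u v.
  move=> uv fuv rvu; rewrite /p; case: pickP => [w /and3P[uw /eqP fuw _]|/(_ v)].
    by rewrite (zero_uniq u v w).
  by rewrite inE /= uv fuv eqxx rvu.
exists p; split=> [u|u v uv fuv].
  rewrite /p; case: pickP => [v /and3P[uv _ _]|_]; last by left.
  by case: (sg_sign_val uv) => ->; [right|left].
have vu : sg_adj S v u by rewrite sg_adj_sym.
have fvu : f v u = 0 by rewrite f_sym // fuv mulr0.
case: (ltngtP (enum_rank u) (enum_rank v)) => [ruv|rvu|/ord_inj/enum_rank_inj euv].
- rewrite (p_up u v) // (p_down v u) // (sg_sign_sym vu).
  by case: (sg_sign_val uv) => ->.
- by rewrite (p_down u v) // (p_up v u) // mulr1.
- by move: uv; rewrite euv (negbTE (sg_adj_irrefl _ _)).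
Qed.

(* The color replacing 0; it is 0 itself unless both palettes contain 0. *)
Definition spare_color (k1 k2 : nat) : int :=
  if odd k1 && odd k2 then (k1./2 + k2./2).+1%:Z else 0.

(** Here [c] is the color of an incidence in the factor, and [g] is the sign p1(u) p2(u') of the
    product vertex (u, u'). *)
Definition left_color (k1 k2 : nat) (g c : int) : int :=
  if c == 0 then g * spare_color k1 k2 else c.

(** Nonzero colors are shifted away from 0, so that the shift commutes with negation and respects
    the sign rule along edges. *)
Definition right_color (k1 k2 : nat) (g c : int) : int :=
  if c == 0 then - g * spare_color k1 k2
  else if 0 < c then c + k1./2%:Z else c - k1./2%:Z.

Section ProductColors.
Variables (k1 k2 : nat) (g : int).
Hypothesis g_sign : g = 1 \/ g = -1.

(** If [k1] and [k2] are both odd, the half of their sum is exactly the spare color. Otherwise the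
    halves add up, and 0 is available as soon as one palette contains it. *)
Lemma left_color_colors c :
  c \in colors k1 -> left_color k1 k2 g c \in colors (k1 + k2).
Proof.
rewrite !inE /left_color /spare_color /=.
by case: g_sign => ->; case: eqP => ?; case odds: (odd k1 && odd k2); lia.
Qed.

Lemma right_color_colors c :
  c \in colors k2 -> right_color k1 k2 g c \in colors (k1 + k2).
Proof.
rewrite !inE /right_color /spare_color /=.
by case: g_sign => ->; case: eqP => ?; case: (ltrP 0 c) => ?;
  case odds: (odd k1 && odd k2); lia.
Qed.

Lemma left_color_inj : {in colors k1 &, injective (left_color k1 k2 g)}.
Proof.
move=> c d; rewrite !inE /left_color /spare_color /=.
by case: g_sign => ->; case: (c =P 0) => ?; case: (d =P 0) => ?;
  case odds: (odd k1 && odd k2); lia.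
Qed.

Lemma right_color_inj : {in colors k2 &, injective (right_color k1 k2 g)}.
Proof.
move=> c d; rewrite !inE /right_color /spare_color /=.
by case: g_sign => ->; case: (c =P 0) => ?; case: (d =P 0) => ?;
  case odds: (odd k1 && odd k2);
  case: (ltrP 0 c) => ?; case: (ltrP 0 d) => ?; lia.
Qed.

(** Nonzero colors are separated by absolute value, at most [k1./2] on the left and above it on the
    right. If [c] and [d] are both 0, both palettes are odd and the two spare colors have opposite
    signs. *)
Lemma left_right_color_neq c d : c \in colors k1 -> d \in colors k2 ->
  left_color k1 k2 g c <> right_color k1 k2 g d.
Proof.
rewrite !inE /left_color /right_color /spare_color /=.
by case: g_sign => ->; case: (c =P 0) => ?; case: (d =P 0) => ?;
  case odds: (odd k1 && odd k2);
  case: (ltrP 0 d) => ?; lia.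
Qed.

End ProductColors.

Lemma left_color_sym k1 k2 (s g h c d : int) : s = 1 \/ s = -1 ->
  c = - s * d -> (c = 0 -> g = - s * h) ->
  left_color k1 k2 g c = - s * left_color k1 k2 h d.
Proof.
move=> hs cd gh; rewrite /left_color.
have -> : (d == 0) = (c == 0) by case: hs cd => -> ->; lia.
by case: eqP => // /gh ->; rewrite mulrA.
Qed.

Lemma right_color_sym k1 k2 (s g h c d : int) : s = 1 \/ s = -1 ->
  c = - s * d -> (c = 0 -> g = - s * h) ->
  right_color k1 k2 g c = - s * right_color k1 k2 h d.
Proof.
move=> hs cd gh; rewrite /right_color.
have -> : (d == 0) = (c == 0) by case: hs cd => -> ->; lia.
case: eqP => [/gh ->|/eqP c0]; first by rewrite mulrA mulrN.
by case: hs cd => -> cd; case: (ltrP 0 c) => ?; case: (ltrP 0 d) => ?; lia.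
Qed.

Lemma product_colorable (T1 T2 : finType) (S1 : sgraph T1) (S2 : sgraph T2) k1 k2 :
  edge_colorable S1 k1 -> edge_colorable S2 k2 ->
  edge_colorable (cartesian_product S1 S2) (k1 + k2).
Proof.
move=> [f1 f1P] [f2 f2P].
have [p1 [p1_sign p1_sym]] := zero_color_potential f1P.
have [p2 [p2_sign p2_sym]] := zero_color_potential f2P.
case: f1P f2P => f1C f1_sym f1_inj [f2C f2_sym f2_inj].
pose g (x : T1 * T2) := p1 x.1 * p2 x.2.
have g_sign x : g x = 1 \/ g x = -1.
  rewrite /g; case: (p1_sign x.1) => ->; case: (p2_sign x.2) => ->;
    by [left|right].
have adjP x y : prod_adj S1 S2 x y ->
    x.1 = y.1 /\ sg_adj S2 x.2 y.2 \/ [/\ x.1 <> y.1, x.2 = y.2 & sg_adj S1 x.1 y.1].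
  case/and3P=> _ _ /orP[/andP[/eqP -> ?]|/andP[xy /eqP ->]]; first by left.
  right; split=> // e; move: xy.
  by rewrite e (negbTE (sg_adj_irrefl _ _)).
exists (fun x y => if x.1 == y.1 then right_color k1 k2 (g x) (f2 x.2 y.2)
                   else left_color k1 k2 (g x) (f1 x.1 y.1)); split=> /=.
- move=> x y /adjP[[-> /f2C xy]|[/eqP/negbTE -> _ /f1C xy]].
    by rewrite eqxx; apply: right_color_colors.
  exact: left_color_colors.
- move=> x y /adjP[[exy xy]|[/eqP/negbTE nxy exy xy]]; rewrite /prod_sign.
    rewrite exy eqxx; apply: right_color_sym (sg_sign_val xy) (f2_sym _ _ xy) _.
    (* Along an edge of the second factor p1 is constant, so [g] inherits the relation of p2. *)
    by move=> /p2_sym; rewrite /g exy mulrCA => ->.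
  rewrite nxy eq_sym nxy.
  apply: left_color_sym (sg_sign_val xy) (f1_sym _ _ xy) _.
  by move=> /p1_sym; rewrite /g exy mulrA => ->.
- move=> x y z /adjP[[exy xy]|[nxy exy xy]] /adjP[[exz xz]|[nxz exz xz]] yz.
  + rewrite exy -exz exy !eqxx => /(right_color_inj (g_sign x)).
    move=> /(_ (f2C _ _ xy) (f2C _ _ xz)); apply: f2_inj => //.
    by apply: contraNneq yz => e; rewrite -pair_eqE /= e -exy -exz !eqxx.
  + rewrite exy eqxx -exy (introF eqP nxz) => /esym.
    by apply: left_right_color_neq => //; [exact: f1C | exact: f2C].
  + rewrite exz eqxx -exz (introF eqP nxy).
    by apply: left_right_color_neq => //; [exact: f1C | exact: f2C].
  + rewrite (introF eqP nxy) (introF eqP nxz) => /(left_color_inj (g_sign x)).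
    move=> /(_ (f1C _ _ xy) (f1C _ _ xz)); apply: f1_inj => //.
    by apply: contraNneq yz => e; rewrite -pair_eqE /= e -exy -exz !eqxx.
Qed.

(** Degrees add at a pair of vertices of maximum degree. Such a pair exists only if neither factor
    is empty: an empty factor makes the product edgeless, whatever the degrees in the other. *)
Lemma product_max_degree_ge (T1 T2 : finType) (S1 : sgraph T1) (S2 : sgraph T2) :
  sg_vertices S1 != set0 -> sg_vertices S2 != set0 ->
  (sg_max_degree S1 + sg_max_degree S2
   <= sg_max_degree (cartesian_product S1 S2))%N.
Proof.
rewrite -!card_gt0 /sg_max_degree => V1 V2.
have [u1 u1V ->] := eq_bigmax_cond (sg_degree S1) V1.
have [u2 u2V ->] := eq_bigmax_cond (sg_degree S2) V2.
have uV : (u1, u2) \in sg_vertices (cartesian_product S1 S2).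
  by rewrite in_setX u1V.
apply: leq_trans (leq_bigmax_cond _ uV); rewrite /sg_degree.
pose N1 := [set (v, u2) | v in [set v | sg_adj S1 u1 v]].
pose N2 := [set (u1, v) | v in [set v | sg_adj S2 u2 v]].
have <- : #|N1| = #|[set v | sg_adj S1 u1 v]| by apply: card_imset => v w [].
have <- : #|N2| = #|[set v | sg_adj S2 u2 v]| by apply: card_imset => v w [].
have disj : [disjoint N1 & N2].
  apply/pred0P => x /=; apply/negP => /andP[/imsetP[v + ->] /imsetP[w _ [e _]]].
  by rewrite inE e (negbTE (sg_adj_irrefl _ _)).
have [_] := leq_card_setU N1 N2; rewrite disj => /eqP <-.
apply/subset_leq_card/subsetP => x; rewrite inE.
have adjV (U : finType) (S : sgraph U) u v : sg_adj S u v -> v \in sg_vertices S.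
  by rewrite sg_adj_sym; apply: sg_adj_vertex.
case/orP => /imsetP[v + ->]; rewrite !inE => uv; apply/and3P; split;
  by rewrite ?in_setX /= ?u1V ?u2V ?(adjV _ _ _ _ uv) ?uv ?eqxx ?orbT.
Qed.

Lemma product_empty_colorable (T1 T2 : finType) (S1 : sgraph T1) (S2 : sgraph T2) :
  (sg_vertices S1 == set0) || (sg_vertices S2 == set0) ->
  edge_colorable (cartesian_product S1 S2) 0.
Proof.
move=> V0; have noadj x y : ~~ sg_adj (cartesian_product S1 S2) x y.
  apply/negP => /sg_adj_vertex; case: x => x1 x2; rewrite in_setX.
  by case/orP: V0 => /eqP ->; rewrite inE ?andbF.
by exists (fun _ _ => 0); split=> [x y|x y|x y z]; rewrite (negbTE (noadj _ _)).
Qed.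

Theorem theorem6 (T : finType) (S1 S2 : sgraph T)
    (hdisj : sg_edge_disjoint S1 S2)
    (h1 : chromatic_index S1 = sg_max_degree S1)
    (h2 : chromatic_index S2 = sg_max_degree S2) :
  chromatic_index (cartesian_product S1 S2)
  = sg_max_degree (cartesian_product S1 S2).
Proof.
apply/eqP; rewrite eqn_leq andbC.
rewrite max_degree_le_colors /=; last exact: chromatic_index_colorable.
case: (boolP ((sg_vertices S1 == set0) || (sg_vertices S2 == set0))) => [V0|].
  by apply: leq_trans (leq0n _); apply/chromatic_index_le/product_empty_colorable.
rewrite negb_or => /andP[V1 V2].
apply: leq_trans (product_max_degree_ge V1 V2); rewrite -h1 -h2.
by apply/chromatic_index_le/product_colorable; apply: chromatic_index_colorable.
Qed.
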